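(* Let $\theta=(\alpha,\beta,\gamma)\in S_n\times S_n\times S_n$. If $\theta\in\mathrm{Atp}(n)$ then $\mathrm{per}(X_s)>0$ for all $s\in[n]$.
   Context: A Latin square of order $n$ is an $n\times n$ array $L=L(i,j)$ with rows, columns and symbols indexed by $[n]=\{1,\dots,n\}$ such that the symbols in every row and in every column are distinct. A triple $(\alpha,\beta,\gamma)\in S_n\times S_n\times S_n$ is an autotopism of $L$ if $\gamma(L(i,j))=L(\alpha(i),\beta(j))$ for all $i,j\in[n]$. $\mathrm{Atp}(n)$ is the set of all triples that are an autotopism of at least one Latin square of order $n$. For $\theta=(\alpha,\beta,\gamma)$ and $s\in[n]$, let $c$ be the length of the cycle of $\gamma$ containing $s$. The $n\times n$ $(0,1)$-matrix $X_s$ is defined by $X_s(i,j)=1$ if $i$ belongs to an $a$-cycle of $\alpha$ and $j$ belongs to a $b$-cycle of $\beta$ such that $\mathrm{lcm}(a,b)=\mathrm{lcm}(b,c)=\mathrm{lcm}(a,c)=\mathrm{lcm}(a,b,c)$, and $X_s(i,j)=0$ otherwise (fixed points are cycles of length $1$). The permanent of an $n\times n$ matrix $X$ is $\mathrm{per}(X)=\sum_{\sigma\in S_n}\prod_{i\in[n]}X(i,\sigma(i))$. *)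

(* Defs.v *)
From HB Require Import structures.
From mathcomp Require Import all_boot all_order all_algebra all_fingroup.

Set Implicit Arguments.
Unset Strict Implicit.
Unset Printing Implicit Defensive.

Import GRing.Theory.
Local Open Scope ring_scope.

(* [n] is 'I_n = {0, ..., n-1}, S_n is 'S_n, an array with symbols in [n] is a
   matrix of type 'M['I_n]_n. *)
Definition latin_square n (L : 'M['I_n]_n) : bool :=
  [forall i, injectiveb (fun j => L i j)] &&
  [forall j, injectiveb (fun i => L i j)].

Definition autotopism n (theta : 'S_n * 'S_n * 'S_n) (L : 'M['I_n]_n) : bool :=
  let: (alpha, beta, gamma) := theta in
  [forall i, forall j, gamma (L i j) == L (alpha i) (beta j)].

Definition Atp n : {set 'S_n * 'S_n * 'S_n} :=
  [set theta | [exists L : 'M['I_n]_n, latin_square L && autotopism theta L]].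

Definition cycle_length n (p : 'S_n) (i : 'I_n) : nat := #|porbit p i|.

Definition X_mx n (theta : 'S_n * 'S_n * 'S_n) (s : 'I_n) : 'M[int]_n :=
  let: (alpha, beta, gamma) := theta in
  let c := cycle_length gamma s in
  \matrix_(i, j)
    let a := cycle_length alpha i in
    let b := cycle_length beta j in
    if [&& lcmn a b == lcmn b c, lcmn b c == lcmn a c
         & lcmn a c == lcmn (lcmn a b) c] then 1 else 0.

Definition permanent (R : comPzSemiRingType) n (A : 'M[R]_n) : R :=
  \sum_(sigma : 'S_n) \prod_(i < n) A i (sigma i).

(* Main.v *)
(* If L i j = s, then theta^m fixes the cell (i, j) as soon as m is a multiple
   of two of the three cycle lengths a, b, c, and two coordinates of a cell of a
   Latin square determine the third; so each of a, b, c divides the lcm of the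
   other two. Hence X_s is 1 on the permutation matrix of the cells of L that
   contain s. *)
Require Import Defs.
From mathcomp Require Import all_boot all_order all_algebra all_fingroup.

Local Open Scope ring_scope.

Import GRing.Theory Num.Theory.

(** With [c] the orbit size, [p ^+ c] fixes [x], so [m] may be reduced modulo [c]; the points [x],
    [p x], ..., up to exponent [c - 1] are distinct, so only remainder 0 fixes [x]. *)
Lemma permX_fix_porbit (T : finType) (p : {perm T}) (x : T) (m : nat) :
  ((p ^+ m)%g x == x) = (#|porbit p x| %| m)%N.
Proof.
set c := #|porbit p x|.
have fixc k : (p ^+ (k * c))%g x = x.
  elim: k => [|k IHk]; first by rewrite mul0n expg0 perm1.
  by rewrite mulSnr expgD permM IHk permX iter_porbit.
have c_gt0 : (0 < c)%N by apply/card_gt0P; exists x; apply: porbit_id.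
rewrite {1}(divn_eq m c) expgD permM fixc permX.
have ltmc : (m %% c < c)%N by rewrite ltn_mod.
rewrite -[X in _ == X]/(iter 0 p x) -(nth_traject p ltmc) -(nth_traject p c_gt0).
by rewrite nth_uniq ?size_traject ?uniq_traject_porbit.
Qed.

Lemma autotopismX n (alpha beta gamma : 'S_n) (L : 'M['I_n]_n) (m : nat) i j :
  autotopism (alpha, beta, gamma) L ->
  (gamma ^+ m)%g (L i j) = L ((alpha ^+ m)%g i) ((beta ^+ m)%g j).
Proof.
move=> /forallP atpL; elim: m => [|m IHm]; first by rewrite !expg0 !perm1.
rewrite !expgSr !permM IHm.
exact/eqP/(forallP (atpL _)).
Qed.

(** Turns the divisibilities that fixed cells provide into the chain of equalities tested in
    [X_mx]. *)
Lemma lcmn_eq_of_dvd a b c :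
  (a %| lcmn b c)%N -> (b %| lcmn a c)%N -> (c %| lcmn a b)%N ->
  [&& lcmn a b == lcmn b c, lcmn b c == lcmn a c
    & lcmn a c == lcmn (lcmn a b) c].
Proof.
move=> ha hb hc; rewrite !eqn_dvd !dvdn_lcm.
by rewrite ha hb hc !dvdn_lcml !dvdn_lcmr -lcmnA dvdn_lcml.
Qed.

Lemma X_mx_latin_cell n (alpha beta gamma : 'S_n) (L : 'M['I_n]_n) i j :
  latin_square L -> autotopism (alpha, beta, gamma) L ->
  X_mx (alpha, beta, gamma) (L i j) i j = 1.
Proof.
move=> /andP[/forallP rowL /forallP colL] atpL; rewrite mxE /= lcmn_eq_of_dvd //.
- set m := lcmn _ _.
  have /eqP bj : (beta ^+ m)%g j == j by rewrite permX_fix_porbit dvdn_lcml.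
  have /eqP gs : (gamma ^+ m)%g (L i j) == L i j.
    by rewrite permX_fix_porbit dvdn_lcmr.
  (* The [m]-th power keeps column [j] and the symbol [L i j], which occurs only once in that
     column, so row [i] is kept too. *)
  rewrite -permX_fix_porbit; apply/eqP/(injectiveP _ (colL j)).
  by rewrite -[in LHS]bj -(autotopismX _ _ _ _ _ _ _ _ atpL) gs.
- set m := lcmn _ _.
  have /eqP ai : (alpha ^+ m)%g i == i by rewrite permX_fix_porbit dvdn_lcml.
  have /eqP gs : (gamma ^+ m)%g (L i j) == L i j.
    by rewrite permX_fix_porbit dvdn_lcmr.
  rewrite -permX_fix_porbit; apply/eqP/(injectiveP _ (rowL i)).
  by rewrite -[in LHS]ai -(autotopismX _ _ _ _ _ _ _ _ atpL) gs.
- set m := lcmn _ _.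
  have /eqP ai : (alpha ^+ m)%g i == i by rewrite permX_fix_porbit dvdn_lcml.
  have /eqP bj : (beta ^+ m)%g j == j by rewrite permX_fix_porbit dvdn_lcmr.
  by rewrite -permX_fix_porbit (autotopismX _ _ _ _ _ _ _ _ atpL) ai bj.
Qed.

(** An injective row of length [n] is a bijection, so [s] has a unique column [f i] in row [i];
    distinctness within columns makes [f] injective. *)
Lemma latin_symbol_perm n (L : 'M['I_n]_n) (s : 'I_n) :
  latin_square L -> exists sigma : 'S_n, forall i, L i (sigma i) = s.
Proof.
move=> /andP[/forallP rowL /forallP colL].
pose f i := invF (injectiveP _ (rowL i)) s.
have Lf i : L i (f i) = s by apply: (f_invF (injectiveP _ (rowL i))).
have f_inj : injective f.
  move=> i k fik; apply: (injectiveP _ (colL (f i))).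
  by rewrite Lf fik Lf.
by exists (perm f_inj) => i; rewrite permE.
Qed.

Lemma X_mx_ge0 n (theta : 'S_n * 'S_n * 'S_n) s i j : 0 <= X_mx theta s i j.
Proof. by case: theta => [[alpha beta] gamma]; rewrite mxE /=; case: ifP. Qed.

Theorem lemma3p8 (n : nat) (theta : 'S_n * 'S_n * 'S_n) :
  theta \in Atp n -> forall s : 'I_n, 0 < permanent (X_mx theta s).
Proof.
rewrite inE => /existsP[L /andP[latL atpL]] s.
have [sigma Lsigma] := latin_symbol_perm _ _ s latL.
(* The [sigma] term is a product of ones, and all other terms are nonnegative. *)
rewrite /permanent (bigD1 sigma) //= ltr_wpDr //.
  by apply: sumr_ge0 => tau _; apply: prodr_ge0 => i _; apply: X_mx_ge0.
rewrite big1 // => i _; case: theta atpL => [[alpha beta] gamma] atpL.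
by rewrite -(Lsigma i) X_mx_latin_cell.
Qed.
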